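(* Let $A\in\mathbb{R}^{n\times n}$ be symmetric positive semidefinite, let $\mu>0$, $A_\mu=A+\mu I$, and let $b\in\mathbb{R}^n$. Let $d_{\mathrm{eff}}(\mu)=\operatorname{tr}(A(A+\mu I)^{-1})$, let $\ell=2\lceil1.5\,d_{\mathrm{eff}}(\mu)\rceil+1$, and let $P$ be the randomized Nyström preconditioner of $A$ with rank parameter $\ell$ and regularization $\mu$. Condition on the event $\{\kappa_2(P^{-1/2}A_\mu P^{-1/2})\le56\}$. Solve the regularized linear system $A_\mu x=b$ using Nyström PCG, that is, the preconditioned conjugate gradient method with preconditioner $P$, starting with the initial iterate $x_0=0$. After $t$ iterations, the relative error $\delta_t$ satisfies $$\delta_t:=\frac{\|x_t-x_\star\|_{\mathrm{PCG}}}{\|x_\star\|_{\mathrm{PCG}}}<2\cdot(0.77)^t,\qquad\text{where }A_\mu x_\star=b.$$ The error norm is defined as $\|u\|_{\mathrm{PCG}}^2=u^T(P^{-1/2}A_\mu P^{-1/2})u$. In particular, $t\ge\lceil3.9\log(2/\epsilon)\rceil$ iterations suffice to achieve relative error $\epsilon$.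
   Context: $\kappa_2$ is the $\ell^2$ (spectral) condition number; $\log$ is the natural logarithm; $\dagger$ is the Moore–Penrose pseudoinverse. A matrix is standard normal if its entries are independent $N(0,1)$ variables. Randomized Nyström preconditioner with rank parameter $\ell$: draw a standard normal matrix $\Omega\in\mathbb{R}^{n\times\ell}$ and form $\hat A_{\mathrm{nys}}=(A\Omega)(\Omega^TA\Omega)^{\dagger}(A\Omega)^T$. Write the eigenvalue decomposition $\hat A_{\mathrm{nys}}=U\hat\Lambda U^T$, where $U\in\mathbb{R}^{n\times\ell}$ has orthonormal columns and $\hat\Lambda=\operatorname{diag}(\hat\lambda_1,\dots,\hat\lambda_\ell)$, $\hat\lambda_1\ge\cdots\ge\hat\lambda_\ell\ge0$. Set $$P=\frac{1}{\hat\lambda_\ell+\mu}\,U(\hat\Lambda+\mu I)U^T+(I-UU^T).$$ Preconditioned conjugate gradient: $r_0=b-A_\mu x_0$, $z_0=P^{-1}r_0$, $p_0=z_0$; for $t=0,1,2,\dots$ set $\alpha_t=(r_t^Tz_t)/(p_t^TA_\mu p_t)$, $x_{t+1}=x_t+\alpha_tp_t$, $r_{t+1}=r_t-\alpha_tA_\mu p_t$, $z_{t+1}=P^{-1}r_{t+1}$, $\beta_t=(r_{t+1}^Tz_{t+1})/(r_t^Tz_t)$, $p_{t+1}=z_{t+1}+\beta_tp_t$.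
   Formalization: As stated the bound fails (already at t=1 for some A, P in the event); the PCG norm is instead applied to P^{1/2}x_t − P^{1/2}x⋆ and P^{1/2}x⋆, i.e. the relative error is measured in the A_μ-energy norm of x_t − x⋆. *)

(* Defs.v *)
From HB Require Import structures.
From mathcomp Require Import all_boot all_order all_algebra.
From mathcomp Require Import all_classical all_reals all_analysis.

Set Implicit Arguments.
Unset Strict Implicit.
Unset Printing Implicit Defensive.

Import Order.TTheory GRing.Theory Num.Theory.

Local Open Scope classical_set_scope.
Local Open Scope ring_scope.

Definition dotcv (R : realType) (n : nat) (u v : 'cV[R]_n) : R :=
  (u^T *m v) 0 0.

Definition l2norm (R : realType) (n : nat) (u : 'cV[R]_n) : R :=
  Num.sqrt (dotcv u u).

Definition psdmx (R : realType) (n : nat) (A : 'M[R]_n) : Prop :=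
  A^T = A /\ forall x : 'cV[R]_n, 0 <= dotcv x (A *m x).

(* The unique positive semidefinite square root of a positive semidefinite
   matrix (0 on other matrices). *)
Definition sqrtmx (R : realType) (n : nat) (A : 'M[R]_n) : 'M[R]_n :=
  xget 0 [set S : 'M[R]_n | psdmx S /\ S *m S = A].

Definition specnorm (R : realType) (n : nat) (A : 'M[R]_n) : R :=
  sup [set l2norm (A *m x) | x in [set x : 'cV[R]_n | l2norm x <= 1]].

(* Meaningful for invertible [A] only: [invmx A = A] when [A] is singular. *)
Definition kappa2 (R : realType) (n : nat) (A : 'M[R]_n) : R :=
  specnorm A * specnorm (invmx A).

(* The four Penrose equations; not to be confused with mathcomp's [pinvmx],
   which is another one-sided partial inverse. *)
Definition penrose (R : realType) (m n : nat) (A : 'M[R]_(m, n))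
    (X : 'M[R]_(n, m)) : Prop :=
  [/\ A *m X *m A = A, X *m A *m X = X,
      (A *m X)^T = A *m X & (X *m A)^T = X *m A].

Definition mp_pinv (R : realType) (m n : nat) (A : 'M[R]_(m, n)) :
    'M[R]_(n, m) :=
  xget 0 (penrose A).

(* Product rule over all finite subfamilies. *)
Definition mutually_independent (R : realType) (d : measure_display)
    (T : measurableType d) (Pr : probability T R) (I : finType)
    (X : I -> {RV Pr >-> R}) : Prop :=
  forall (J : {set I}) (B : I -> set R), (forall i, measurable (B i)) ->
    (Pr (\bigcap_(i in [set i | i \in J]) (X i @^-1` B i))
       = \prod_(i in J) Pr (X i @^-1` B i))%E.

Definition standard_normal_entries (R : realType) (d : measure_display)
    (T : measurableType d) (Pr : probability T R) (m n : nat)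
    (X : 'I_m -> 'I_n -> {RV Pr >-> R}) : Prop :=
  (forall i j (B : set R), measurable B ->
     distribution Pr (X i j) B = normal_prob (0 : R) 1 B) /\
  mutually_independent (fun ij : 'I_m * 'I_n => X ij.1 ij.2).

Definition sample_mx (R : realType) (d : measure_display)
    (T : measurableType d) (Pr : probability T R) (m n : nat)
    (X : 'I_m -> 'I_n -> {RV Pr >-> R}) (w : T) : 'M[R]_(m, n) :=
  \matrix_(i, j) X i j w.

Definition regularized (R : realType) (n : nat) (A : 'M[R]_n) (mu : R) :
    'M[R]_n :=
  A + mu%:M.

Definition d_eff (R : realType) (n : nat) (A : 'M[R]_n) (mu : R) : R :=
  \tr (A *m invmx (regularized A mu)).

(* For [A] positive semidefinite and [0 < mu] the ceiling is nonnegative, so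
   the absolute value merely casts it to [nat]. *)
Definition nystrom_rank_pred (R : realType) (n : nat) (A : 'M[R]_n) (mu : R) :
    nat :=
  (2 * `|Num.ceil (3 / 2 * d_eff A mu)|)%N.

Notation nystrom_rank A mu := (nystrom_rank_pred A mu).+1.

Definition nystrom_approx (R : realType) (n l : nat) (A : 'M[R]_n)
    (Omega : 'M[R]_(n, l)) : 'M[R]_n :=
  (A *m Omega) *m mp_pinv (Omega^T *m A *m Omega) *m (A *m Omega)^T.

Definition ordered_evd (R : realType) (n l : nat) (B : 'M[R]_n)
    (U : 'M[R]_(n, l)) (lam : 'rV[R]_l) : Prop :=
  [/\ B = U *m diag_mx lam *m U^T,
      U^T *m U = 1%:M,
      (forall i j : 'I_l, (i <= j)%N -> lam 0 j <= lam 0 i) &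
      (forall i, 0 <= lam 0 i)].

Definition nystrom_precond_of (R : realType) (n k : nat) (mu : R)
    (U : 'M[R]_(n, k.+1)) (lam : 'rV[R]_k.+1) : 'M[R]_n :=
  (lam 0 ord_max + mu)^-1 *: (U *m (diag_mx lam + mu%:M) *m U^T)
  + (1%:M - U *m U^T).

Definition is_nystrom_precond (R : realType) (n k : nat) (A : 'M[R]_n)
    (mu : R) (Omega : 'M[R]_(n, k.+1)) (P : 'M[R]_n) : Prop :=
  exists (U : 'M[R]_(n, k.+1)) (lam : 'rV[R]_k.+1),
    ordered_evd (nystrom_approx A Omega) U lam /\
    P = nystrom_precond_of mu U lam.

Definition preconditioned (R : realType) (n : nat) (P M : 'M[R]_n) :
    'M[R]_n :=
  invmx (sqrtmx P) *m M *m invmx (sqrtmx P).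

Record pcg_state (R : realType) (n : nat) := PCGState {
  pcg_x : 'cV[R]_n;
  pcg_r : 'cV[R]_n;
  pcg_z : 'cV[R]_n;
  pcg_p : 'cV[R]_n
}.

Definition pcg_init (R : realType) (n : nat) (M P : 'M[R]_n)
    (b x0 : 'cV[R]_n) : pcg_state R n :=
  let r := b - M *m x0 in
  let z := invmx P *m r in
  PCGState x0 r z z.

(* Since [0 / 0 = 0], the iterate stays put once the residual vanishes. *)
Definition pcg_step (R : realType) (n : nat) (M P : 'M[R]_n)
    (s : pcg_state R n) : pcg_state R n :=
  let: PCGState x r z p := s in
  let alpha := dotcv r z / dotcv p (M *m p) in
  let x' := x + alpha *: p in
  let r' := r - alpha *: (M *m p) in
  let z' := invmx P *m r' in
  let beta := dotcv r' z' / dotcv r z in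
  PCGState x' r' z' (z' + beta *: p).

Definition pcg_iterate (R : realType) (n : nat) (M P : 'M[R]_n)
    (b x0 : 'cV[R]_n) (t : nat) : 'cV[R]_n :=
  pcg_x (iter t (pcg_step M P) (pcg_init M P b x0)).

Definition pcg_norm (R : realType) (n : nat) (P M : 'M[R]_n)
    (u : 'cV[R]_n) : R :=
  Num.sqrt (dotcv u (preconditioned P M *m u)).

(* [pcg_norm] is the energy norm of the symmetrically preconditioned system
   [preconditioned P M *m y = invmx (sqrtmx P) *m b], whose unknown is
   [y = sqrtmx P *m x]; errors are therefore measured in that variable.
   Applied to [x - xstar] itself, the norm admits no bound of the form
   [2 * (77 / 100) ^+ t].  The quotient is 0 when [xstar = 0]. *)
Definition pcg_rel_error (R : realType) (n : nat) (P M : 'M[R]_n)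
    (x xstar : 'cV[R]_n) : R :=
  pcg_norm P M (sqrtmx P *m x - sqrtmx P *m xstar) /
  pcg_norm P M (sqrtmx P *m xstar).

(* Main.v *)
(** With B = A + mu I and S = P^(1/2), the error norm of S (x_t - x) is the
    B-energy norm of x_t - x, so everything happens in the original variables.
    The condition number bound gives a P <= B <= 56 a P <= (225/4) a P for some
    a > 0.  PCG minimises the energy error over the Krylov space of G = P^-1 B,
    so it is compared with a Chebyshev polynomial T in the affine variable Y
    mapping [a, c] to [-1, 1], c = (225/4) a.  Instead of diagonalising G, we use
    the Pell identity T^2 + (1 - Y^2) W^2 = 1: as B (1 - Y(G)^2) is positive
    semidefinite, T(G) does not increase the energy norm.  The choice of the
    rational square 225/4 > 56 makes the rate rational, namely 13/17 < 77/100. *)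

Require Import Defs.
From mathcomp Require Import all_boot all_order all_algebra.
From mathcomp Require Import all_classical all_reals all_analysis.
From mathcomp Require Import ring lra.

Set Implicit Arguments.
Unset Strict Implicit.
Unset Printing Implicit Defensive.

Import Order.TTheory GRing.Theory Num.Theory.

Local Open Scope ring_scope.

(** * Dot product and positive definite matrices *)

Section DotProduct.
Context {R : realType} {n : nat}.
Implicit Types (u v w x y : 'cV[R]_n) (A : 'M[R]_n) (c : R).

Lemma dotcvE u v : dotcv u v = \sum_i u i 0 * v i 0.
Proof. by rewrite /dotcv mxE; apply: eq_bigr => i _; rewrite mxE. Qed.

Lemma dotcvC u v : dotcv u v = dotcv v u.
Proof. by rewrite !dotcvE; apply: eq_bigr => i _; rewrite mulrC. Qed.

Lemma dotcvDr u v w : dotcv u (v + w) = dotcv u v + dotcv u w.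
Proof. by rewrite /dotcv mulmxDr mxE. Qed.

Lemma dotcvZr c u v : dotcv u (c *: v) = c * dotcv u v.
Proof. by rewrite /dotcv -scalemxAr mxE. Qed.

Lemma dotcvNr u v : dotcv u (- v) = - dotcv u v.
Proof. by rewrite /dotcv mulmxN mxE. Qed.

Lemma dotcvDl u v w : dotcv (v + w) u = dotcv v u + dotcv w u.
Proof. by rewrite !(dotcvC _ u) dotcvDr. Qed.

Lemma dotcvZl c u v : dotcv (c *: v) u = c * dotcv v u.
Proof. by rewrite !(dotcvC _ u) dotcvZr. Qed.

Lemma dotcvNl u v : dotcv (- v) u = - dotcv v u.
Proof. by rewrite !(dotcvC _ u) dotcvNr. Qed.

Lemma dotcv0r u : dotcv u 0 = 0.
Proof. by rewrite /dotcv mulmx0 mxE. Qed.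

Lemma dotcv0l u : dotcv 0 u = 0.
Proof. by rewrite dotcvC dotcv0r. Qed.

Lemma dotcv_ge0 u : 0 <= dotcv u u.
Proof. by rewrite dotcvE sumr_ge0 // => i _; rewrite -expr2 sqr_ge0. Qed.

Lemma dotcv_gt0 u : u != 0 -> 0 < dotcv u u.
Proof.
move=> u0; rewrite lt_neqAle dotcv_ge0 andbT eq_sym.
apply: contra u0; rewrite dotcvE psumr_eq0 => [/allP h|i _]; last first.
  by rewrite -expr2 sqr_ge0.
apply/eqP/matrixP => i j; rewrite ord1 mxE.
by have /eqP := h i (mem_index_enum i) => /eqP; rewrite mulf_eq0 orbb => /eqP.
Qed.

Lemma sqr_le_dotcv u i : u i 0 ^+ 2 <= dotcv u u.
Proof.
rewrite dotcvE (bigD1 i) //= expr2 lerDl sumr_ge0 // => j _.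
by rewrite -expr2 sqr_ge0.
Qed.

Lemma dotcv_sym A x y : A^T = A -> dotcv (A *m x) y = dotcv x (A *m y).
Proof. by move=> As; rewrite /dotcv trmx_mul As mulmxA. Qed.

End DotProduct.

Lemma dotcv_adj (R : realType) (m n : nat) (A : 'M[R]_(m, n)) x y :
  dotcv (A *m x) y = dotcv x (A^T *m y).
Proof. by rewrite /dotcv trmx_mul mulmxA. Qed.

Definition dotcv_lin {R : realType} {n : nat} :=
  (@dotcvDr R n, @dotcvDl R n, @dotcvNr R n, @dotcvNl R n, @dotcvZr R n,
   @dotcvZl R n, @dotcv0r R n, @dotcv0l R n).

Definition posdefmx (R : realType) (n : nat) (A : 'M[R]_n) : Prop :=
  A^T = A /\ forall x : 'cV[R]_n, x != 0 -> 0 < dotcv x (A *m x).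

Section PositiveDefinite.
Context {R : realType} {n : nat}.
Implicit Types (A B S : 'M[R]_n) (x : 'cV[R]_n).

Lemma posdefmx_ge0 A x : posdefmx A -> 0 <= dotcv x (A *m x).
Proof.
case=> _ Apos; have [->|/Apos/ltW//] := eqVneq x 0.
by rewrite dotcv0l.
Qed.

Lemma posdefmx_unit A : posdefmx A -> A \in unitmx.
Proof.
case=> As Apos; rewrite unitmxE unitfE; apply/det0P => -[v v0 vA].
have vT0 : v^T != 0 by rewrite -trmx0 (inj_eq trmx_inj).
have := Apos _ vT0; rewrite -{1}As -trmx_mul vA trmx0 dotcv0r.
by rewrite ltxx.
Qed.

Lemma posdefmx_inv A : posdefmx A -> posdefmx (invmx A).
Proof.
move=> Ad; have Au := posdefmx_unit Ad; case: Ad => As Apos.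
split=> [|x x0]; first by rewrite trmx_inv As.
have y0 : invmx A *m x != 0.
  by apply: contra x0 => /eqP h; rewrite -[x](mulKVmx Au) h mulmx0.
by have := Apos _ y0; rewrite mulKVmx // dotcvC.
Qed.

Lemma posdefmx_congr A S :
  posdefmx A -> S^T = S -> S \in unitmx -> posdefmx (S *m A *m S).
Proof.
case=> As Apos Ss Su; split=> [|x x0].
  by rewrite !trmx_mul Ss As mulmxA.
have y0 : S *m x != 0.
  by apply: contra x0 => /eqP h; rewrite -[x](mulKmx Su) h mulmx0.
by have := Apos _ y0; rewrite dotcv_sym // !mulmxA.
Qed.

Lemma posdefmx_regularized A (mu : R) :
  psdmx A -> 0 < mu -> posdefmx (regularized A mu).
Proof.
case=> As A0 mu0; split=> [|x x0].
  by rewrite /regularized raddfD /= As tr_scalar_mx.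
rewrite /regularized mulmxDl mul_scalar_mx !dotcv_lin.
by rewrite ltr_wpDl // mulr_gt0 // dotcv_gt0.
Qed.

End PositiveDefinite.

(** * From the spectral condition number to bounds on quadratic forms *)

Section SpectralNorm.
Context {R : realType} {n : nat}.
Implicit Types (A M : 'M[R]_n) (x : 'cV[R]_n).

Lemma l2norm_ge0 x : 0 <= l2norm x.
Proof. exact: sqrtr_ge0. Qed.

Lemma sqr_l2norm x : l2norm x ^+ 2 = dotcv x x.
Proof. by rewrite sqr_sqrtr // dotcv_ge0. Qed.

Lemma l2norm_gt0 x : x != 0 -> 0 < l2norm x.
Proof. by move=> x0; rewrite sqrtr_gt0 dotcv_gt0. Qed.

Lemma l2normZ c x : l2norm (c *: x) = `|c| * l2norm x.
Proof.
by rewrite /l2norm !dotcv_lin mulrA -expr2 sqrtrM ?sqr_ge0 // sqrtr_sqr.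
Qed.

(** A supremum in [R] is an upper bound only of a bounded set, so [specnorm] needs this. Entries of
    a vector in the unit ball are at most 1 in absolute value, so the row sums of [|A i j|] bound
    its image. *)
Lemma mulmx_unit_ball_bounded A :
  exists C, forall x, l2norm x <= 1 -> l2norm (A *m x) <= C.
Proof.
exists (Num.sqrt (\sum_i (\sum_j `|A i j|) ^+ 2)) => x x1.
rewrite ler_sqrt; last by rewrite sumr_ge0 // => i _; rewrite sqr_ge0.
rewrite dotcvE ler_sum // => i _.
rewrite -expr2 -real_normK ?num_real // lerXn2r ?nnegrE ?normr_ge0 ?sumr_ge0 //.
rewrite mxE (le_trans (ler_norm_sum _ _ _)) // ler_sum // => j _.
rewrite normrM ler_piMr // -(@ler_pXn2r _ 2) ?nnegrE // expr1n.
rewrite real_normK ?num_real // (le_trans (sqr_le_dotcv _ _)) //.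
by rewrite -sqr_l2norm expr_le1 // l2norm_ge0.
Qed.

Lemma l2norm_mulmx_le A x : l2norm (A *m x) <= specnorm A * l2norm x.
Proof.
have [->|x0] := eqVneq x 0; first by rewrite mulmx0 /l2norm dotcv0l sqrtr0 mulr0.
have nx := l2norm_gt0 x0.
rewrite -ler_pdivrMr // mulrC.
have -> : (l2norm x)^-1 * l2norm (A *m x) = l2norm (A *m ((l2norm x)^-1 *: x)).
  by rewrite -scalemxAr l2normZ ger0_norm // invr_ge0 ltW.
have [C hC] := mulmx_unit_ball_bounded A.
apply: ub_le_sup; first by exists C => _ [y y1 <-]; exact: hC.
exists ((l2norm x)^-1 *: x) => //=.
by rewrite l2normZ ger0_norm ?invr_ge0 ?l2norm_ge0 // mulVf ?gt_eqF.
Qed.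

Lemma specnorm_gt0 A x : A *m x != 0 -> 0 < specnorm A.
Proof.
move=> Ax; have := lt_le_trans (l2norm_gt0 Ax) (l2norm_mulmx_le A x).
rewrite !ltNge; apply: contra => s0.
by rewrite mulr_le0_ge0 // l2norm_ge0.
Qed.

(* AM-GM in place of Cauchy-Schwarz: expand [|c x - A x|^2 >= 0] with
   [c = specnorm A]. *)
Lemma quadform_le_specnorm A x :
  0 < specnorm A -> dotcv x (A *m x) <= specnorm A * dotcv x x.
Proof.
move=> c0; set c := specnorm A in c0 *.
have h1 : dotcv (A *m x) (A *m x) <= c ^+ 2 * dotcv x x.
  rewrite -!sqr_l2norm -exprMn lerXn2r ?nnegrE ?l2norm_ge0 ?l2norm_mulmx_le //.
  by rewrite mulr_ge0 ?l2norm_ge0 ?ltW.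
have := dotcv_ge0 (c *: x - A *m x); rewrite !dotcv_lin (dotcvC (A *m x) x).
move=> h2; rewrite -(ler_pM2l c0); nra.
Qed.

(* [c M (c - M) = M (c - M) M + (c - M) M (c - M)] is positive semidefinite. *)
Lemma sqr_le_quadform M (c : R) x :
  posdefmx M -> 0 < c -> (forall y, dotcv y (M *m y) <= c * dotcv y y) ->
  dotcv (M *m x) (M *m x) <= c * dotcv x (M *m x).
Proof.
move=> Md c0 Mc; have Ms : M^T = M by case: Md.
have := Mc (M *m x); have := posdefmx_ge0 (c *: x - M *m x) Md.
rewrite !(mulmxDr, mulmxN, =^~ scalemxAr) !dotcv_lin !(dotcv_sym _ _ Ms).
move=> h1 h2; rewrite -(ler_pM2l c0); nra.
Qed.

(** Here [a] is the inverse of [specnorm (invmx M)]. The lower bound is [sqr_le_quadform] for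
    [invmx M] at the vector [M *m x]. The condition [0 < n] provides a nonzero vector, which makes
    both norms positive. *)
Lemma kappa2_quadform M :
  (0 < n)%N -> posdefmx M -> kappa2 M <= 56 ->
  exists2 a : R, 0 < a & forall x, a * dotcv x x <= dotcv x (M *m x) /\
    dotcv x (M *m x) <= 56 * a * dotcv x x.
Proof.
move=> n0 Md; have Mu := posdefmx_unit Md; have Kd := posdefmx_inv Md.
have x0 : (const_mx 1 : 'cV[R]_n) != 0.
  by apply/eqP => /matrixP /(_ (Ordinal n0) 0); rewrite !mxE; apply/eqP/oner_neq0.
have s0 A : posdefmx A -> 0 < specnorm A.
  case=> _ Ap; apply: (@specnorm_gt0 _ (const_mx 1)).
  by apply: contraTneq (Ap _ x0) => ->; rewrite dotcv0r ltxx.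
rewrite /kappa2 => k56; exists (specnorm (invmx M))^-1; first by rewrite invr_gt0 s0.
move=> x; split.
  have := sqr_le_quadform (M *m x) Kd (s0 _ Kd)
    (fun y => quadform_le_specnorm y (s0 _ Kd)).
  by rewrite mulKmx // (dotcvC (M *m x)) -ler_pdivrMl ?s0.
apply: le_trans (quadform_le_specnorm x (s0 _ Md)) _.
by rewrite ler_wpM2r ?dotcv_ge0 // ler_pdivlMr ?s0.
Qed.

End SpectralNorm.

(** * Definiteness and square root of the Nyström preconditioner *)

Section NystromPreconditioner.
Context {R : realType} {n k : nat} (mu : R).
Variables (U : 'M[R]_(n, k.+1)) (lam : 'rV[R]_k.+1).
Hypotheses (mu_gt0 : 0 < mu) (UU : U^T *m U = 1%:M).
Hypothesis lam_sorted : forall i j : 'I_k.+1, (i <= j)%N -> lam 0 j <= lam 0 i.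
Hypothesis lam_ge0 : forall i, 0 <= lam 0 i.

Local Notation nu := (lam 0 ord_max + mu).
(** For orthonormal columns of [U], this multiplies column [i] by [g i] and fixes the orthogonal
    complement. A square root is then obtained by taking square roots of the [g i]. *)
Local Notation damp g := (1%:M + U *m diag_mx (\row_i (g i - 1)) *m U^T).

Definition nystrom_ratio (i : 'I_k.+1) : R := (lam 0 i + mu) / nu.

Let nu_gt0 : 0 < nu.
Proof. by rewrite ltr_wpDl. Qed.

Let ratio_ge1 i : 1 <= nystrom_ratio i.
Proof. by rewrite ler_pdivlMr // mul1r lerD2r lam_sorted // -ltnS. Qed.

Lemma nystrom_precondE : nystrom_precond_of mu U lam = damp nystrom_ratio.
Proof.
rewrite /nystrom_precond_of addrC -addrA; congr (_ + _).
have -> : diag_mx (\row_i (nystrom_ratio i - 1)) = nu^-1 *: (diag_mx lam + mu%:M) - 1%:M.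
  apply/matrixP => i j; rewrite !mxE /nystrom_ratio mulrC.
  by case: eqVneq => [->|_]; rewrite ?mulr1n ?mulr0n ?addr0 ?mulr0 ?subr0.
by rewrite mulmxBr mulmxBl mulmx1 -scalemxAr -scalemxAl addrC.
Qed.

Lemma psdmx_damp (g : 'I_k.+1 -> R) : (forall i, 1 <= g i) ->
  psdmx (damp g) /\ forall x : 'cV[R]_n, dotcv x x <= dotcv x (damp g *m x).
Proof.
move=> g1.
have dg (x : 'cV[R]_n) : dotcv x x <= dotcv x (damp g *m x).
  rewrite mulmxDl mul1mx dotcvDr lerDl -!mulmxA -{1}(trmxK U) -dotcv_adj.
  set y := U^T *m x; rewrite dotcvE sumr_ge0 // => i _.
  rewrite mul_diag_mx !mxE mulrCA -expr2 mulr_ge0 ?sqr_ge0 //.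
  by rewrite subr_ge0.
split=> //; split=> [|x]; last by rewrite (le_trans (dotcv_ge0 x)).
by rewrite linearD /= trmx1 !trmx_mul trmxK tr_diag_mx mulmxA.
Qed.

Lemma posdefmx_nystrom : posdefmx (nystrom_precond_of mu U lam).
Proof.
rewrite nystrom_precondE; have [[ds _] dg] := psdmx_damp ratio_ge1.
by split=> // x x0; apply: lt_le_trans (dotcv_gt0 x0) (dg x).
Qed.

Lemma sqrtmx_nystrom : let P := nystrom_precond_of mu U lam in
  psdmx (sqrtmx P) /\ sqrtmx P *m sqrtmx P = P.
Proof.
(* [xget] returns a member of the set as soon as there is one, so exhibiting a root is enough. *)
rewrite /= /sqrtmx; apply: (@xgetPex _ _ [set S | psdmx S /\ S *m S = _])%classic.
rewrite nystrom_precondE; exists (damp (fun i => Num.sqrt (nystrom_ratio i))); split.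
  by apply: (psdmx_damp _).1 => i; rewrite -sqrtr1 ler_wsqrtr.
rewrite mulmxDr mulmx1 mulmxDl mul1mx -addrA; congr (_ + _).
rewrite -!mulmxA (mulmxA U^T) UU mul1mx (mulmxA (diag_mx _)) mulmx_diag.
rewrite -!mulmxDr -!mulmxDl; congr (_ *m (_ *m _)).
apply/matrixP => i j; rewrite !mxE -!mulrnDl; congr (_ *+ _).
(* With [s] the root of the ratio, this is [2 (s - 1) + (s - 1)^2 = s^2 - 1]. *)
have := sqr_sqrtr (le_trans ler01 (ratio_ge1 i)); lra.
Qed.

End NystromPreconditioner.

Lemma sqrtmx_unit (R : realType) (n : nat) (S P : 'M[R]_n) :
  P \in unitmx -> S *m S = P -> S \in unitmx.
Proof. by move=> Pu SP; move: Pu; rewrite -SP unitmx_mul andbb. Qed.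

(** * Polynomials in a [P]-self-adjoint matrix and the Chebyshev bound *)

Section SelfAdjoint.
Context {R : realType} {n : nat} (P G : 'M[R]_n.+1).
Hypotheses (Ps : P^T = P) (PGs : (P *m G)^T = P *m G).
Implicit Types (f : {poly R}) (x y : 'cV[R]_n.+1).

Lemma horner_mx_adj f : P *m horner_mx G f = (horner_mx G f)^T *m P.
Proof.
elim/poly_ind: f => [|f c IH]; first by rewrite rmorph0 trmx0 mulmx0 mul0mx.
rewrite rmorphD rmorphM /= horner_mx_X horner_mx_C -mulmxE.
rewrite mulmxDr linearD /= mulmxDl tr_scalar_mx scalar_mxC; congr (_ + _).
have Gf : horner_mx G f *m G = G *m horner_mx G f by exact: comm_horner_mx.
rewrite trmx_mul -mulmxA -IH Gf !mulmxA; congr (_ *m _).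
by rewrite -{2}Ps -trmx_mul PGs.
Qed.

Lemma dotcv_horner_mx f x y :
  dotcv (horner_mx G f *m x) (P *m y) = dotcv x (P *m (horner_mx G f *m y)).
Proof. by rewrite dotcv_adj !mulmxA horner_mx_adj. Qed.

End SelfAdjoint.

(* Chebyshev polynomials [T], [W] of the first and second kind in the variable
   [Y]: the recursion is the addition theorem of cosine and sine, and
   [Y.[0] = (q + 1/q) / 2] makes [T.[0]] a hyperbolic cosine. *)
Lemma chebyshev_pell (R : realType) (Y : {poly R}) (q : R) (k : nat) :
  (size Y <= 2)%N -> 0 < q -> Y.[0] = (q^-1 + q) / 2 ->
  exists T W : {poly R}, [/\ (size T <= k.+1)%N,
    T ^+ 2 + (1 - Y ^+ 2) * W ^+ 2 = 1 & T.[0] = (q ^- k + q ^+ k) / 2].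
Proof.
move=> sY q0 Y0.
(* The induction also carries the size and the value at 0 of [W]. The factor [q^-1 - q] stays on the
   left so that [q = 1] causes no division by zero. *)
suff [T [W [sT _ TW T0 _]]] : exists T W : {poly R},
    [/\ (size T <= k.+1)%N, (size W <= k)%N, T ^+ 2 + (1 - Y ^+ 2) * W ^+ 2 = 1,
        T.[0] = (q ^- k + q ^+ k) / 2 &
        W.[0] * (q^-1 - q) = q ^- k - q ^+ k].
  by exists T, W.
have q_neq0 : q != 0 by rewrite gt_eqF.
have sYM (p : {poly R}) m : (size p <= m)%N -> (size (Y * p)%R <= m.+1)%N.
  move=> sp; apply: leq_trans (size_polyMleq _ _) _.
  by rewrite -subn1 leq_subLR (leq_add sY sp).
elim: k => [|k [T [W [sT sW TW T0 W0]]]].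
  exists 1, 0; split; rewrite ?size_poly1 ?size_poly0 //; first by ring.
    by rewrite hornerC expr0 invr1; field.
  by rewrite horner0 mul0r expr0 invr1 subrr.
exists (Y * T - (1 - Y ^+ 2) * W), (Y * W + T); split.
- have -> : Y * T - (1 - Y ^+ 2) * W = Y * T + (Y * (Y * W) - W) by ring.
  rewrite (leq_trans (size_polyD _ _)) // geq_max sYM //=.
  rewrite (leq_trans (size_polyD _ _)) // geq_max !sYM //= size_polyN.
  by rewrite (leq_trans sW) // -addn2 leq_addr.
- by rewrite (leq_trans (size_polyD _ _)) // geq_max sYM.
- by rewrite -[RHS]TW; ring.
(* At 0, [1 - Y^2 = - ((q^-1 - q) / 2)^2], which restores the factor carried with [W.[0]]. *)
- have -> : (Y * T - (1 - Y ^+ 2) * W).[0] =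
      Y.[0] * T.[0] + ((q^-1 - q) / 4) * (W.[0] * (q^-1 - q)).
    by rewrite !(hornerD, hornerN, hornerM, horner_exp, hornerC) Y0; field.
  by rewrite Y0 T0 W0 !exprS; field; rewrite expf_neq0.
- have -> : (Y * W + T).[0] * (q^-1 - q) =
      Y.[0] * (W.[0] * (q^-1 - q)) + T.[0] * (q^-1 - q).
    by rewrite !(hornerD, hornerM); ring.
  by rewrite Y0 T0 W0 !exprS; field; rewrite expf_neq0.
Qed.

(** By the Pell identity, [X - X T^2 = X (1 - Y^2) W^2], a nonnegative multiple of
    [W (X (X - a) (c - X)) W]; it remains to see that the middle factor is semidefinite at [G]. *)
Lemma chebyshev_contraction (R : realType) (n : nat) (P G : 'M[R]_n.+1)
    (a c : R) (Y T W : {poly R}) :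
  P^T = P -> (P *m G)^T = P *m G -> 0 <= a -> a < c ->
  (forall x, a * dotcv x (P *m x) <= dotcv x (P *m (G *m x))) ->
  (forall x, dotcv x (P *m (G *m x)) <= c * dotcv x (P *m x)) ->
  Y = (c - a)^-1 *: ((c + a)%:P - 'X *+ 2) ->
  T ^+ 2 + (1 - Y ^+ 2) * W ^+ 2 = 1 ->
  forall x, dotcv (horner_mx G T *m x) (P *m (G *m (horner_mx G T *m x))) <=
    dotcv x (P *m (G *m x)).
Proof.
move=> Ps PGs a0 ac lo hi YE TW x; set y := _ *m x.
pose ip (u v : 'cV[R]_n.+1) := dotcv u (P *m v).
pose H (f : {poly R}) (v : 'cV[R]_n.+1) := horner_mx G f *m v.
have HM f g v : H (f * g) v = H f (H g v) by rewrite /H rmorphM -mulmxE mulmxA.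
have HD f g v : H (f + g) v = H f v + H g v by rewrite /H rmorphD mulmxDl.
have ipH f u v : ip (H f u) v = ip u (H f v) by exact: dotcv_horner_mx.
have HX v : H 'X v = G *m v by rewrite /H horner_mx_X.
have HC b v : H b%:P v = b *: v by rewrite /H horner_mx_C mul_scalar_mx.
have ipZ b u v : ip u (b *: v) = b * ip u v by rewrite /ip -scalemxAr dotcvZr.
have ipD u v w : ip u (v + w) = ip u v + ip u w by rewrite /ip mulmxDr dotcvDr.
have L v : 0 <= ip v (H ('X - a%:P) v).
  rewrite -polyCN HD HX HC ipD ipZ.
  by have := lo v; rewrite -/(ip _ _) -/(ip _ _); lra.
have U v : 0 <= ip v (H (c%:P - 'X) v).
  rewrite -mulN1r -polyC1 -polyCN HD HM HX !HC ipD !ipZ.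
  by have := hi v; rewrite -/(ip _ _) -/(ip _ _); lra.
set D := 'X - a%:P in L; set E := c%:P - 'X in U.
have conj_ge0 f g v : (forall u, 0 <= ip u (H g u)) -> 0 <= ip v (H (f * (g * f)) v).
  by move=> g0; rewrite !HM -ipH.
(* Since [D + E = c - a], the multiple [(c - a) D E] is [D E D + E D E], a sum of two congruences of
   semidefinite forms. *)
have psdDE v : 0 <= ip v (H (D * E) v).
  have ca : 0 < c - a by rewrite subr_gt0.
  rewrite -(pmulr_rge0 _ ca) -ipZ -HC -HM.
  have -> : (c - a)%:P * (D * E) = D * (E * D) + E * (D * E).
    by rewrite /D /E polyCB; ring.
  by rewrite HD ipD addr_ge0 // conj_ge0.
have psdXDE v : 0 <= ip v (H ('X * D * E) v).
  have -> : 'X * D * E = D * (E * D) + a%:P * (D * E) by rewrite /D; ring.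
  by rewrite HD ipD (HM a%:P) HC ipZ addr_ge0 ?conj_ge0 // mulr_ge0.
have -> : dotcv y (P *m (G *m y)) = ip x (H ('X * T ^+ 2) x).
  by rewrite mulrC -mulrA HM -ipH mulrC HM HX.
rewrite -/(ip x _) -subr_ge0 -HX.
have -> : ip x (H 'X x) = ip x (H ('X * T ^+ 2 + ((2 / (c - a)) ^+ 2)%:P *
     (W * ('X * D * E * W))) x).
  congr (ip x (H _ x)); rewrite -[LHS]mulr1 -TW.
  have ca1 : (c - a)^-1%:P * (c%:P - a%:P) = 1 :> {poly R}.
    by rewrite -polyCB -polyCM mulVf // subr_eq0 gt_eqF.
  (* [1 - Y = 2 (X - a) / (c - a)] and [1 + Y = 2 (c - X) / (c - a)]. *)
  have -> : 1 - Y ^+ 2 = ((2 / (c - a)) ^+ 2)%:P * (D * E).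
    rewrite -[1 in LHS](expr1n _ 2) -ca1 YE -mul_polyC /D /E.
    by rewrite !(polyCM, polyCD); ring.
  by ring.
by rewrite HD ipD addrC addKr HM HC ipZ mulr_ge0 ?sqr_ge0 ?conj_ge0.
Qed.

(** * Energy optimality of PCG and its convergence rate *)

Definition energy (R : realType) (n : nat) (B : 'M[R]_n) (u : 'cV[R]_n) : R :=
  dotcv u (B *m u).

Section PCGOptimality.
Context {R : realType} {n : nat} (B P : 'M[R]_n.+1).
Hypotheses (Bd : posdefmx B) (Pd : posdefmx P).
Variables b xstar x0 : 'cV[R]_n.+1.
Hypothesis bE : B *m xstar = b.

Local Notation G := (invmx P *m B).
Local Notation z0 := (G *m (xstar - x0)).
Let Bs : B^T = B := Bd.1.
Let Qd := posdefmx_inv Pd.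
Let Qs : (invmx P)^T = invmx P := Qd.1.

(** The vector [z0] is the initial preconditioned residual [P^-1 (b - B x0)]. Polynomials as
    witnesses allow a direct comparison with the Chebyshev polynomial. *)
Definition krylov (t : nat) (v : 'cV[R]_n.+1) : Prop :=
  exists2 f : {poly R}, (size f <= t)%N & v = horner_mx G f *m z0.

Lemma krylovD t u v : krylov t u -> krylov t v -> krylov t (u + v).
Proof.
move=> [f sf ->] [g sg ->]; exists (f + g); last by rewrite rmorphD mulmxDl.
by rewrite (leq_trans (size_polyD _ _)) // geq_max sf.
Qed.

Lemma krylovZ t c v : krylov t v -> krylov t (c *: v).
Proof.
move=> [f sf ->]; exists (c *: f); first by rewrite (leq_trans (size_scale_leq _ _)).
by rewrite linearZ /= scalemxAl.
Qed.

Lemma krylovB t u v : krylov t u -> krylov t v -> krylov t (u - v).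
Proof. by move=> ku kv; rewrite -scaleN1r; apply/krylovD/krylovZ. Qed.

Lemma krylovW t v : krylov t v -> krylov t.+1 v.
Proof. by move=> [f sf ->]; exists f => //; rewrite ltnW. Qed.

Lemma krylovG t v : krylov t v -> krylov t.+1 (G *m v).
Proof.
move=> [f sf ->]; exists (f * 'X).
  by rewrite (leq_trans (size_polyMleq _ _)) // size_polyX addn2.
by rewrite mulrC rmorphM /= horner_mx_X mulmxA.
Qed.

(** Orthogonality is stated against the whole Krylov space rather than against each earlier residual
    or direction, so an induction on single states suffices. The last field makes [alpha] the exact
    line search along [p]. *)
Record pcg_inv (t : nat) (s : pcg_state R n.+1) : Prop := PCGInv {
  pcg_inv_r : pcg_r s = B *m (xstar - pcg_x s);
  pcg_inv_z : pcg_z s = invmx P *m pcg_r s;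
  pcg_inv_x : krylov t (pcg_x s - x0);
  pcg_inv_zK : krylov t.+1 (pcg_z s);
  pcg_inv_pK : krylov t.+1 (pcg_p s);
  pcg_inv_orth : forall v, krylov t v -> dotcv (pcg_r s) v = 0;
  pcg_inv_conj : forall v, krylov t v -> dotcv (pcg_p s) (B *m v) = 0;
  pcg_inv_rp : dotcv (pcg_r s) (pcg_p s) = dotcv (pcg_r s) (pcg_z s)
}.

(* If [p] lay in the smaller Krylov space, then [r] would be orthogonal to it;
   but [<r, p> = <r, z> > 0]. *)
Lemma krylov_split t s v : pcg_inv t s -> pcg_r s != 0 -> krylov t.+1 v ->
  exists c w, krylov t w /\ v = w + c *: pcg_p s.
Proof.
case=> _ zE _ _ [g sg pE] orth _ rp r0 [f sf ->].
(* So [p] comes from a polynomial of degree exactly [t], and a multiple of it cancels the top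
   coefficient of [f]. *)
have gt0 : g`_t != 0.
  apply/negP => /eqP gt0.
  have : dotcv (pcg_r s) (pcg_p s) = 0.
    apply: orth; exists g => //; rewrite leqNgt; apply/negP => tg.
    have gs : size g = t.+1 by apply/eqP; rewrite eqn_leq sg.
    have := lead_coef_eq0 g; rewrite lead_coefE gs gt0 eqxx => /esym/eqP g0.
    by rewrite g0 size_poly0 in gs.
  by rewrite rp zE => h; have := Qd.2 _ r0; rewrite h ltxx.
exists (f`_t / g`_t), (horner_mx G (f - (f`_t / g`_t) *: g) *m z0); split.
  exists (f - (f`_t / g`_t) *: g) => //.
  apply/leq_sizeP => j; rewrite leq_eqVlt => /predU1P[<-|tj].
    by rewrite coefB coefZ divfK // subrr.
  have hj (h : {poly R}) : (size h <= t.+1)%N -> h`_j = 0.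
    by move=> sh; rewrite nth_default // (leq_trans sh).
  by rewrite coefB coefZ !hj // mulr0 subr0.
by rewrite pE rmorphB /= horner_mxZ mulmxBl -scalemxAl subrK.
Qed.

Lemma pcg_inv_init : pcg_inv 0 (pcg_init B P b x0).
Proof.
have k0 v : krylov 0 v -> v = 0.
  by move=> [f]; rewrite leqn0 size_poly_eq0 => /eqP -> ->; rewrite rmorph0 mul0mx.
have rE : b - B *m x0 = B *m (xstar - x0) by rewrite mulmxBr bE.
have zK : krylov 1 (invmx P *m (b - B *m x0)).
  by exists 1; rewrite ?size_poly1 // rmorph1 mul1mx rE mulmxA.
split=> //=.
- by rewrite subrr; exists 0; rewrite ?size_poly0 // rmorph0 mul0mx.
- by move=> v /k0 ->; rewrite dotcv0r.
- by move=> v /k0 ->; rewrite mulmx0 dotcv0r.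
Qed.

(** A nonzero residual keeps both denominators positive. The old Krylov space is already conjugate
    to [z'], so [beta] has to correct only the component along [p]. *)
Lemma pcg_inv_step t s :
  pcg_inv t s -> pcg_r s != 0 -> pcg_inv t.+1 (pcg_step B P s).
Proof.
move=> inv r0; have split_p v := krylov_split inv r0 (v := v).
case: inv; case: s r0 split_p => x r z p /= r0 split_p.
move=> rE zE xK zK pK orth conj rp.
have rz : 0 < dotcv r z by rewrite zE; exact: Qd.2.
have p0 : p != 0 by apply: contraTneq rz => p0; rewrite -rp p0 dotcv0r ltxx.
have pBp := Bd.2 _ p0.
set alpha := dotcv r z / _.
have alpha0 : alpha != 0 by rewrite mulf_neq0 ?invr_eq0 ?gt_eqF.
set r' := r - _; set z' := _ *m r'; set beta := _ / _.
have z'E : z' = z - alpha *: (G *m p).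
  by rewrite /z' /r' mulmxBr -zE -scalemxAr mulmxA.
have z'K : krylov t.+2 z'.
  by rewrite z'E; apply: krylovB; [exact: krylovW | apply/krylovZ/krylovG].
have orth' v : krylov t.+1 v -> dotcv r' v = 0.
  move=> /split_p[c [w [wK ->]]].
  rewrite /r' !dotcv_lin !(dotcv_sym _ _ Bs) (orth _ wK) (conj _ wK) rp.
  by rewrite /alpha divfK ?gt_eqF //; ring.
have r'p : dotcv r' p = 0 by exact: orth'.
split=> //=.
- by rewrite /r' rE !mulmxBr mulmxDr -scalemxAr opprD addrA.
- by rewrite addrAC; apply: krylovD; [exact: krylovW | exact: krylovZ].
- by apply: krylovD => //; apply/krylovW/krylovZ.
- move=> _ /split_p[c [w [wK ->]]].
  rewrite mulmxDr -scalemxAr dotcvDl !dotcvDr !dotcvZl !dotcvZr (conj _ wK).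
  (* This product equals [<r', G w>], and [G w] lies in the space to which [r'] is orthogonal. *)
  have -> : dotcv z' (B *m w) = 0.
    rewrite /z' dotcv_sym // mulmxA; exact/orth'/krylovG.
  have Bp : B *m p = alpha^-1 *: (r - r').
    by rewrite /r' opprB addrC subrK scalerA mulVf // scale1r.
  have -> : dotcv z' (B *m p) = - (alpha^-1 * dotcv r' z').
    rewrite Bp dotcvZr dotcvDr dotcvNr {1}/z' dotcv_sym // -zE orth' // dotcvC.
    by rewrite add0r mulrN.
  rewrite /beta /alpha; field.
  by rewrite !gt_eqF.
- by rewrite dotcvDr dotcvZr r'p mulr0 addr0.
Qed.

(** The second case is early termination: a zero residual makes [alpha] zero, and the iterate stays
    at [xstar]. *)
Lemma pcg_iterate_inv t :
  let s := iter t (pcg_step B P) (pcg_init B P b x0) in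
  pcg_inv t s \/ pcg_x s = xstar /\ pcg_r s = 0.
Proof.
elim: t => [|t IH] /=; first by left; exact: pcg_inv_init.
set s := iter t _ _ in IH *; case: IH => [inv|]; last first.
  by case: s => x r z p /= [-> ->]; right; rewrite dotcv0l mul0r !scale0r addr0 subr0.
have [r0|r0] := eqVneq (pcg_r s) 0; last by left; exact: pcg_inv_step.
have xE : pcg_x s = xstar.
  apply/esym/eqP; rewrite -subr_eq0.
  by rewrite -(mulKmx (posdefmx_unit Bd) (_ - _)) -(pcg_inv_r inv) r0 mulmx0.
right; case: s r0 xE {inv} => x r z p /= -> ->.
by rewrite dotcv0l mul0r !scale0r addr0 subr0.
Qed.

(** The competing error differs from the PCG error by a Krylov vector, which is [B]-orthogonal to
    the PCG error, so Pythagoras applies. *)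
Lemma pcg_iterate_optimal t (f : {poly R}) : (size f <= t.+1)%N -> f.[0] = 1 ->
  energy B (pcg_iterate B P b x0 t - xstar) <=
    energy B (horner_mx G f *m (x0 - xstar)).
Proof.
move=> sf f0; rewrite /energy /pcg_iterate; set e' := horner_mx G f *m _.
case: (pcg_iterate_inv t); set s := iter t _ _; last first.
  by move=> [-> _]; rewrite subrr dotcv0l posdefmx_ge0.
move=> inv; set et := _ - xstar.
(* With [f = 1 + g X], the competing error is [(x0 - xstar) - g(G) z0]. *)
have [g sg fE] : exists2 g : {poly R}, (size g <= t)%N & f = 1 + g * 'X.
  have /factor_theorem[g gE] : root (f - 1) 0 by rewrite rootE !hornerE f0 subrr.
  rewrite subr0 in gE.
  exists g; last by rewrite -gE addrC subrK.
  have [->|g0] := eqVneq g 0; first by rewrite size_poly0.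
  rewrite -ltnS -(size_mulX g0) -gE (leq_trans (size_polyD _ _)) // geq_max sf.
  by rewrite size_polyN size_poly1.
have [d dK e'E] : exists2 d, krylov t d & e' = et + d.
  exists (x0 - pcg_x s - horner_mx G g *m z0).
    apply: krylovB; last by exists g.
    by rewrite -opprB -scaleN1r; apply/krylovZ/(pcg_inv_x inv).
  rewrite /e' fE rmorphD rmorph1 rmorphM /= horner_mx_X mulmxDl mul1mx.
  rewrite -mulmxE -mulmxA -(opprB x0 xstar) !mulmxN opprK /et.
  by rewrite addrA; congr (_ + _); rewrite addrC subrKA.
have etd : dotcv et (B *m d) = 0.
  rewrite -dotcv_sym // /et -opprB mulmxN -(pcg_inv_r inv) dotcvNl.
  by rewrite (pcg_inv_orth inv) // oppr0.
rewrite e'E; move: (et) etd => u ud.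
rewrite mulmxDr !dotcv_lin ud -(dotcv_sym d u Bs) (dotcvC _ u) ud.
by rewrite addr0 add0r lerDl posdefmx_ge0.
Qed.

End PCGOptimality.

(* [a P <= B <= (225/4) a P] bounds the relative condition number by
   [(15/2)^2], for which [(sqrt kappa - 1) / (sqrt kappa + 1) = 13/17]. *)
Lemma pcg_convergence (R : realType) (n : nat) (B P : 'M[R]_n)
    (b xstar x0 : 'cV[R]_n) (a : R) (t : nat) :
  posdefmx B -> posdefmx P -> B *m xstar = b -> 0 < a ->
  (forall x, a * energy P x <= energy B x) ->
  (forall x, energy B x <= 225 / 4 * a * energy P x) ->
  x0 != xstar ->
  energy B (pcg_iterate B P b x0 t - xstar) <
    (2 * (13 / 17) ^+ t) ^+ 2 * energy B (x0 - xstar).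
Proof.
(* [horner_mx] requires a positive dimension; in dimension 0 the two vectors coincide. *)
case: n B P b xstar x0 => [|n] B P b xstar x0 Bd Pd bE a0 lo hi x0_neq.
  by rewrite (flatmx0 x0) (flatmx0 xstar) eqxx in x0_neq.
set q : R := 13 / 17; set c := 225 / 4 * a in hi.
have PG : P *m (invmx P *m B) = B by rewrite mulKVmx // posdefmx_unit.
have q0 : 0 < q by rewrite /q; lra.
have ac : a < c by rewrite /c; lra.
pose Y : {poly R} := (c - a)^-1 *: ((c + a)%:P - 'X *+ 2).
have sY : (size Y <= 2)%N.
  rewrite (leq_trans (size_scale_leq _ _)) // (leq_trans (size_polyD _ _)) //.
  rewrite geq_max size_polyN -scaler_nat (leq_trans (size_polyC_leq1 _)) //=.
  by rewrite (leq_trans (size_scale_leq _ _)) // size_polyX.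
(* Both sides equal 229/221: the left one is [(c + a) / (c - a)]. *)
have Y0 : Y.[0] = (q^-1 + q) / 2.
  rewrite hornerZ hornerD hornerN hornerMn hornerC hornerX mul0rn subr0 /q /c; field.
  by apply: lt0r_neq0; lra.
have [T [W [sT TW T0]]] := chebyshev_pell t sY q0 Y0.
set m := (_ + _) / 2 in T0 *.
have m0 : 0 < m by rewrite divr_gt0 // addr_gt0 ?invr_gt0 ?exprn_gt0.
have opt := pcg_iterate_optimal Bd Pd x0 bE (t := t) (f := m^-1 *: T).
have {opt} := opt (leq_trans (size_scale_leq _ _) sT).
rewrite hornerZ T0 mulVf ?gt_eqF // => /(_ erefl).
rewrite horner_mxZ -scalemxAl /energy -scalemxAr dotcvZl dotcvZr.
set Te := horner_mx _ T *m _; rewrite mulrA -expr2 => Ete.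
have PGx x : P *m (invmx P *m B *m x) = B *m x by rewrite mulmxA PG.
have : dotcv Te (B *m Te) <= dotcv (x0 - xstar) (B *m (x0 - xstar)).
  rewrite -!PGx; apply: (chebyshev_contraction Pd.1 _ (ltW a0) ac _ _ erefl TW).
  - by rewrite PG Bd.1.
  - by move=> x; rewrite PGx; exact: lo.
  - by move=> x; rewrite PGx; exact: hi.
move=> /(ler_wpM2l (sqr_ge0 m^-1)) /(le_trans Ete) /le_lt_trans; apply.
rewrite ltr_pM2r; last by apply: Bd.2; rewrite subr_eq0.
have qt0 : 0 < q ^+ t by rewrite exprn_gt0.
suff m_lt : m^-1 < 2 * q ^+ t.
  by rewrite ltr_pXn2r ?nnegrE ?invr_ge0 ?(ltW m0) ?(ltW (lt_trans _ m_lt)) ?invr_gt0.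
rewrite -(ltr_pM2r m0) mulVf ?gt_eqF //.
(* The term [q^(2t)] gives the strict inequality. *)
have -> : 2 * q ^+ t * m = 1 + q ^+ t * q ^+ t.
  by rewrite /m; field; rewrite gt_eqF.
by rewrite ltrDl mulr_gt0.
Qed.

(* [expR (- x) >= (1 - x / 8) ^+ 8] at [x = 10/39]. *)
Lemma expR_rate (R : realType) : (77 / 100 : R) <= expR (- (10 / 39)).
Proof.
have -> : - (10 / 39) = (8%:R : R) * (- (5 / 156)) by field.
rewrite expRM_natl.
have h : (151 / 156 : R) <= expR (- (5 / 156)).
  by apply: le_trans (expR_ge1Dx _); lra.
apply: le_trans (lerXn2r 8 _ _ h); rewrite ?nnegrE ?expR_ge0 //; lra.
Qed.

(** * Return to the preconditioned norm and assembly *)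

Lemma energy_sqrtmx (R : realType) (n : nat) (S B : 'M[R]_n) (x : 'cV[R]_n) :
  S^T = S -> S \in unitmx ->
  dotcv (S *m x) (invmx S *m B *m invmx S *m (S *m x)) = energy B x.
Proof.
by move=> Ss Su; rewrite -!mulmxA mulKmx // dotcv_sym // mulKVmx.
Qed.

Theorem corollary1p2 (R : realType) (n : nat) (A : 'M[R]_n) (mu : R)
  (b : 'cV[R]_n) (xstar : 'cV[R]_n)
  (d : measure_display) (T : measurableType d) (Pr : probability T R)
  (X : 'I_n -> 'I_(nystrom_rank A mu) -> {RV Pr >-> R})
  (P : T -> 'M[R]_n)
  (psdA : psdmx A)
  (mu_gt0 : 0 < mu)
  (X_std_normal : standard_normal_entries X)
  (P_nystrom : forall w : T, is_nystrom_precond A mu (sample_mx X w) (P w))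
  (xstarE : regularized A mu *m xstar = b) :
  forall w : T,
    kappa2 (preconditioned (P w) (regularized A mu)) <= 56 ->
    let delta (t : nat) : R :=
      pcg_rel_error (P w) (regularized A mu)
        (pcg_iterate (regularized A mu) (P w) b 0 t) xstar in
    (forall t : nat, delta t < 2 * (77 / 100) ^+ t) /\
    (forall (eps : R) (t : nat), 0 < eps ->
       Num.ceil (39 / 10 * ln (2 / eps)) <= t%:Z -> delta t <= eps).

Proof.
move=> w k56 delta.
have [U [lam [[_ UU lam_sorted lam_ge0] PE]]] := P_nystrom w.
have Pd : posdefmx (P w) by rewrite PE; exact: posdefmx_nystrom.
have [[Ss _] SS] : psdmx (sqrtmx (P w)) /\ sqrtmx (P w) *m sqrtmx (P w) = P w.
  by rewrite PE; exact: sqrtmx_nystrom.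
have Bd := posdefmx_regularized psdA mu_gt0.
(* The orthonormal columns of [U], at least one in number, fit into dimension [n]. *)
have n0 : (0 < n)%N.
  apply: (@leq_trans (nystrom_rank A mu)) => //; rewrite -[leqLHS](@mxrank1 R) -UU.
  exact: leq_trans (mxrankM_maxr _ _) (rank_leq_row U).
set B := regularized A mu in Bd k56 delta xstarE *.
set S := sqrtmx (P w) in Ss SS k56 *.
have Su : S \in unitmx := sqrtmx_unit (posdefmx_unit Pd) SS.
have deltaE t : delta t =
    Num.sqrt (energy B (pcg_iterate B (P w) b 0 t - xstar)) /
    Num.sqrt (energy B (0 - xstar)).
  rewrite /delta /pcg_rel_error /pcg_norm /preconditioned -/S -mulmxBr.
  rewrite !energy_sqrtmx //; congr (_ / Num.sqrt _).
  by rewrite sub0r /energy mulmxN !dotcv_lin opprK.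
have [a a0 ha] : exists2 a : R, 0 < a & forall x,
    a * energy (P w) x <= energy B x /\ energy B x <= 225 / 4 * a * energy (P w) x.
  have Md : posdefmx (preconditioned (P w) B).
    apply: posdefmx_congr => //; first by rewrite trmx_inv Ss.
    by rewrite unitmx_inv.
  have [a a0 ha] := kappa2_quadform n0 Md k56.
  (* Substituting [S *m x] turns bounds relative to the identity into bounds relative to [P], as
     [S *m S = P]. *)
  exists a => // x; have := ha (S *m x); rewrite energy_sqrtmx //.
  rewrite dotcv_sym // mulmxA SS -/(energy _ _) => -[lo hi]; split=> //.
  apply: le_trans hi _; rewrite ler_wpM2r ?posdefmx_ge0 //; lra.
have rate t : delta t < 2 * (77 / 100) ^+ t.
  have r0 : 0 < 2 * (77 / 100 : R) ^+ t by rewrite mulr_gt0 ?exprn_gt0 //; lra.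
  (* For [xstar = 0] the quotient is 0 by the convention for division by zero. *)
  rewrite deltaE; have [<-|xs0] := eqVneq 0 xstar.
    by rewrite subrr /energy dotcv0l sqrtr0 invr0 mulr0.
  have E0 : 0 < energy B (0 - xstar) by apply: Bd.2; rewrite subr_eq0.
  rewrite ltr_pdivrMr ?sqrtr_gt0 //.
  have q0 : 0 <= 2 * (13 / 17 : R) ^+ t by rewrite mulr_ge0 ?exprn_ge0 //; lra.
  apply: (@lt_le_trans _ _ (2 * (13 / 17) ^+ t * Num.sqrt (energy B (0 - xstar)))).
    rewrite -[X in X * _](ger0_norm q0) -sqrtr_sqr -sqrtrM ?sqr_ge0 //.
    rewrite ltr_sqrt; last by rewrite mulr_gt0 // exprn_gt0 // mulr_gt0 ?exprn_gt0 //; lra.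
    by apply: (pcg_convergence t Bd Pd xstarE a0) => // x; case: (ha x).
  rewrite ler_wpM2r ?sqrtr_ge0 // ler_wpM2l // lerXn2r ?nnegrE //; lra.
split=> // eps t eps0 ht; apply: le_trans (ltW (rate t)) _.
(* As [10/39 = 1/3.9], the count gives [2 / eps <= exp (10 t / 39)], while [expR_rate] gives
   [0.77^t <= exp (- 10 t / 39)]. *)
have {}ht : ln (2 / eps) <= 10 / 39 * t%:R.
  by move: ht; rewrite ceil_le_int => ht; lra.
have : 2 / eps <= expR (10 / 39 * t%:R).
  by rewrite -[leLHS]lnK ?ler_expR // posrE divr_gt0.
rewrite ler_pdivrMr // => h.
have h2 : (77 / 100 : R) ^+ t <= expR (- (10 / 39 * t%:R)).
  rewrite -mulNr expRM_natr lerXn2r ?nnegrE ?expR_ge0 ?expR_rate //; lra.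
apply: le_trans (ler_wpM2l _ h2) _ => //.
by rewrite expRN ler_pdivrMr ?expR_gt0 // mulrC.
Qed.
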